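(* For every real $\epsilon>0$ there exists an integer $d\geq1$, depending only on $\epsilon$, such that for every $E\subseteq\mathbb{Z}^2$ with $\overline d(E)>\epsilon$ there exist $(x,y),(x',y')\in E$ with $$(x-x')^2-(y-y')^2=d^2.$$
   Context: For $E\subseteq\mathbb{Z}^2$, the (ordinary) upper density is $$\overline d(E):=\limsup_{N\to\infty}\frac{|E\cap[-N,N]^2|}{(2N+1)^2},$$ where $[-N,N]^2$ denotes the set of integer points in that square. *)

(* Defs.v *)
From mathcomp Require Import all_boot all_order all_algebra finmap.
From mathcomp Require Import all_classical all_reals all_analysis.
From mathcomp Require Import zify.

Set Implicit Arguments.
Unset Strict Implicit.
Unset Printing Implicit Defensive.

Import Order.TTheory GRing.Theory Num.Theory.

Local Open Scope classical_set_scope.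
Local Open Scope ring_scope.

Definition box (N : nat) : set (int * int) :=
  [set p | (- N%:Z <= p.1 <= N%:Z) /\ (- N%:Z <= p.2 <= N%:Z)].

Lemma finite_box (N : nat) : finite_set (box N).
Proof.
pose f (i : nat) : int := i%:Z - N%:Z.
pose I := f @` `I_(2 * N + 1).
have mem (z : int) : - N%:Z <= z <= N%:Z -> I z.
  move=> /andP[z1 z2]; exists (absz (z + N%:Z)).
    by rewrite /mkset; lia.
  by rewrite /f; lia.
have Ifin : finite_set I by exact/finite_image/finite_II.
apply: (@sub_finite_set _ _ (I `*` I)); last exact: finite_setX.
by move=> p [p1 p2]; split; exact: mem.
Qed.

(* fset_set A is empty when A is infinite, which finite_box rules out here. *)
Definition box_density (R : realType) (E : set (int * int)) (N : nat) : R :=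
  (#|` fset_set (E `&` box N)|)%fset%:R / ((2 * N + 1) ^ 2)%N%:R.

(* The sequence takes its values in [0, 1], so the real-valued limn_sup
   is the genuine limit superior. *)
Definition upper_density (R : realType) (E : set (int * int)) : R :=
  limn_sup (box_density R E).

(* Main.v *)
Require Import Defs.
From HB Require Import structures.
From mathcomp Require Import all_boot all_order all_algebra.
From mathcomp Require Import all_classical all_reals all_analysis.
From mathcomp Require Import zify ring lra.

Import Order.TTheory GRing.Theory Num.Theory.

Local Open Scope classical_set_scope.
Local Open Scope ring_scope.

(** The vector (u + v, v - u) has squared length 4 u v for the form
    x^2 - y^2, so it suffices to find two points of E that differ by the image
    of some (u, v) with u v = w^2, where w depends only on the density; then
    d = 2 w.

    Finding two points of a dense set A in a finite abelian group that differ
    by pi (u, v) is a matter of showing that the autocorrelation of A is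
    positive at pi (u, v).  No three points of the plane have all their
    mutual differences on the hyperbola u v = w^2, so pigeonholing translates of
    A does not suffice; instead, w^2 is chosen with many divisors.
    Let t run over the products of the i^(e_i), 1 <= i <= m, 0 <= e_i < m, let
    s = (m!^m)^2 / t, and let phi (a, b) be the average over t of the normalised
    autocorrelation of A at pi (a t, b s).  This phi is positive definite on
    Z^2, phi 0 = 1, and phi - delta is still positive semidefinite when A has
    density delta.  Multiplying t by some n <= m hardly changes the range of t,
    so phi (n a, b) is close to phi (a, n b) ([averaged_corr_form]).  Hence, up
    to a small error and for coordinates of size at most m, phi (a, b) depends
    only on the product a b when b <> 0, and phi (a, 0) is the same for all
    a <> 0.

    The second fact says that the vectors representing the (r, 0) have equal
    mutual inner products, so they form a system that is orthogonal up to a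
    common component, and Bessel's inequality bounds the total squared deviation
    of the numbers phi (r, -1) from their mean kappa by 2 ([bessel]).  Hence
    phi (p i) averages to about kappa along every family of points whose
    coordinate products are negative and pairwise distinct
    ([equidistribution_points]).

    Now take N points v_j = (2^j, 2^(2N-j)) on the hyperbola a b = 4^N, and N
    points z_j far away from them.  All differences within and between the two
    families have negative products, and along each row of the difference table,
    on either side of the diagonal, the products are distinct.  Therefore
    the inner products of the vectors of the v_j and z_j are all about kappa on
    average, the two averages are close to each other in norm, and phi (v_j) is on average about phi (z_j), which is
    about kappa.  Since phi - delta is positive semidefinite, kappa is at least
    about delta, so that phi (v_j) > 0 for some j ([hyperbola_recurrence]).
    Unfolding phi, some (u, v) = (2^j t, 2^(2N-j) s) is a difference in A, and
    u v = (2^N m!^m)^2.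

    A subset of Z^2 of upper density above eps is cut down to a large square,
    which is embedded in a torus too large for the relevant translations to
    wrap around. *)

(** * Positive definite functions that see only the product of the coordinates *)

(** The abstract shadow of a set of density [delta]: positive definiteness
    carries the Hilbert space geometry, [delta] bounds from below the mass at
    the trivial character, and [form_scale] is the approximate invariance under
    the dilations (a, b) |-> (n a, b / n), cleared of denominators. *)
Record hyperbolic_form {R : realFieldType} (delta : R) (m : nat)
    (phi : int * int -> R) : Prop := HyperbolicForm {
  form_at0 : phi 0 = 1;
  form_ge0 : forall p, 0 <= phi p;
  form_even : forall p, phi (- p) = phi p;
  form_psd : forall (I : finType) (c : I -> R) (p : I -> int * int),
    delta * (\sum_i c i) ^+ 2 <= \sum_i \sum_j c i * c j * phi (p i - p j);
  form_scale : forall (n : nat) (a b : int), (0 < n <= m)%N ->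
    `|phi (n%:Z * a, b) - phi (a, n%:Z * b)| <= m%:R^-1 }.
Arguments form_at0 {R delta m phi}.
Arguments form_ge0 {R delta m phi}.
Arguments form_even {R delta m phi}.
Arguments form_psd {R delta m phi}.
Arguments form_scale {R delta m phi}.

(** The second coordinate is -1 so that a natural number [r] parametrises the
    points whose coordinate product is [- r]. *)
Definition corr {R : realFieldType} (phi : int * int -> R) (r : nat) : R :=
  phi (r%:Z, - 1%:Z).

Definition mean_corr {R : realFieldType} (phi : int * int -> R) (m : nat) : R :=
  (\sum_(r < m) corr phi r) / m%:R.

Lemma form_axis {R : realFieldType} {delta : R} {m : nat}
    {phi : int * int -> R} (n : nat) :
  hyperbolic_form delta m phi -> (0 < n <= m)%N ->
  `|phi (n%:Z, 0) - phi (1, 0)| <= m%:R^-1.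
Proof.
move=> H hn; have := form_scale H n 1 0 hn.
by rewrite mulr1 mulr0.
Qed.

Lemma form_axis_dist {R : realFieldType} {delta : R} {m : nat}
    {phi : int * int -> R} (r s : 'I_m) :
  hyperbolic_form delta m phi -> r != s ->
  `|phi ((r%:Z, 0) - (s%:Z, 0)) - phi (1, 0)| <= m%:R^-1.
Proof.
move=> H; wlog lt_sr : r s / (s < r)%N.
  move=> W; case: (ltngtP s r) => [lt_sr|lt_rs|/val_inj ->]; last by rewrite eqxx.
    exact: W.
  rewrite eq_sym => ne; rewrite -(form_even H) opprB.
  exact: W.
move=> _.
have -> : (r%:Z, 0) - (s%:Z, 0) = ((r - s)%N%:Z, 0) :> (int * int)%type.
  by congr pair => /=; lia.
by apply: form_axis H _; have := ltn_ord r; lia.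
Qed.

(** The squared norm of a sum of two combinations of the vectors that represent
    points, expanded: all Cauchy-Schwarz type arguments below are instances. *)
Lemma form_split {R : realFieldType} {delta : R} {m : nat}
    {phi : int * int -> R} {I J : finType} (c : I -> R) (c' : J -> R)
    (p : I -> int * int) (p' : J -> int * int) :
  hyperbolic_form delta m phi -> 0 <= delta ->
  0 <= \sum_i \sum_j c i * c j * phi (p i - p j)
     + 2 * (\sum_i \sum_j c i * c' j * phi (p i - p' j))
     + \sum_i \sum_j c' i * c' j * phi (p' i - p' j).
Proof.
move=> H d0.
pose C (x : I + J) := match x with inl i => c i | inr j => c' j end.
pose P (x : I + J) := match x with inl i => p i | inr j => p' j end.
have := form_psd H (I + J)%type C P.
have := mulr_ge0 d0 (sqr_ge0 (\sum_i C i)) => /le_trans/[apply].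
rewrite big_sumType /=.
under eq_bigr do rewrite big_sumType /=.
under [X in _ + X]eq_bigr do rewrite big_sumType /=.
rewrite !big_split /=.
have -> : \sum_i \sum_i0 c' i * c i0 * phi (p' i - p i0)
   = \sum_i \sum_j c i * c' j * phi (p i - p' j).
  rewrite exchange_big; apply: eq_bigr => i _; apply: eq_bigr => j _ /=.
  by rewrite -(form_even H) opprB; ring.
by move=> h; apply: le_trans h _; lra.
Qed.

(** Any two vectors representing distinct (r, 0) and (t, 0) have inner product
    about phi (1, 0), so a combination whose coefficients sum to zero has squared
    norm at most about the sum of the squares of the coefficients.  Testing the
    combination with coefficients corr r - mean against the vector of (0, 1),
    which has norm 1, gives the bound. *)
Lemma bessel {R : realFieldType} {delta : R} {m : nat} {phi : int * int -> R} :
  hyperbolic_form delta m phi -> 0 <= delta -> (0 < m)%N ->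
  \sum_(r < m) (corr phi r - mean_corr phi m) ^+ 2 <= 2.
Proof.
move=> H d0 m0.
have mR : 0 < m%:R :> R by rewrite ltr0n.
set k := mean_corr phi m.
pose s (r : 'I_m) := corr phi r - k.
pose B := \sum_r s r ^+ 2.
have B0 : 0 <= B by apply: sumr_ge0 => r _; exact: sqr_ge0.
have sum_s : \sum_r s r = 0.
  rewrite /s sumrB sumr_const card_ord -mulr_natr /k /mean_corr.
  by rewrite mulfVK ?subrr // gt_eqF.
have sumsC : \sum_r s r * corr phi r = B.
  transitivity (\sum_r (s r ^+ 2 + k * s r)).
    by apply: eq_bigr => r _; rewrite /s; ring.
  by rewrite big_split /= -mulr_sumr sum_s mulr0 addr0.
pose g := phi (1, 0).
have quad : \sum_r \sum_t s r * s t * phi ((r%:Z, 0) - (t%:Z, 0)) <= 2 * B.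
  (* Subtracting the common value g is free because the s r sum to zero. *)
  have -> : \sum_r \sum_t s r * s t * phi ((r%:Z, 0) - (t%:Z, 0))
          = \sum_r \sum_t s r * s t * (phi ((r%:Z, 0) - (t%:Z, 0)) - g).
    apply: eq_bigr => r _.
    transitivity (\sum_t (s r * s t * phi ((r%:Z, 0) - (t%:Z, 0)) - s r * g * s t)).
      by rewrite sumrB -mulr_sumr sum_s mulr0 subr0.
    by apply: eq_bigr => t _; ring.
  have term r t : s r * s t * (phi ((r%:Z, 0) - (t%:Z, 0)) - g)
      <= (if t == r then s r ^+ 2 else 0) + (s r ^+ 2 + s t ^+ 2) / 2 / m%:R.
    have am : `|s r * s t| <= (s r ^+ 2 + s t ^+ 2) / 2.
      have := sqr_ge0 (s r - s t); have := sqr_ge0 (s r + s t).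
      by rewrite ler_norml; nra.
    case: eqP => [->|/eqP ne].
      rewrite subrr (form_at0 H).
      have g0 : 0 <= g := form_ge0 H _.
      have : 0 <= (s r ^+ 2 + s r ^+ 2) / 2 / m%:R.
        by rewrite divr_ge0 ?ler0n // divr_ge0 // addr_ge0 ?sqr_ge0.
      by have := sqr_ge0 (s r); nra.
    rewrite add0r; apply: le_trans (ler_norm _) _; rewrite normrM.
    apply: ler_pM => //; apply: form_axis_dist H _.
    by rewrite eq_sym.
  apply: le_trans (ler_sum _ (fun r _ => ler_sum _ (fun t _ => term r t))) _.
  have row r : \sum_t ((if t == r then s r ^+ 2 else 0)
      + (s r ^+ 2 + s t ^+ 2) / 2 / m%:R)
      = s r ^+ 2 + (m%:R * s r ^+ 2 + B) / 2 / m%:R.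
    rewrite big_split /= -big_mkcond /= big_pred1_eq.
    by rewrite -!mulr_suml big_split /= sumr_const card_ord -/B -[_ *+ m]mulr_natl.
  under eq_bigr do rewrite row.
  rewrite big_split /= -/B -!mulr_suml big_split /= -mulr_sumr -/B.
  rewrite sumr_const card_ord -[B *+ m]mulr_natl.
  have -> : (m%:R * B + m%:R * B) / 2 / m%:R = B.
    by field; rewrite gt_eqF.
  lra.
have := form_split s (fun _ : unit => - B) (fun r => (r%:Z, 0))
  (fun=> (0, 1)) H d0.
rewrite [X in _ + 2 * X](_ : _ = - B * B); last first.
  rewrite -[X in _ = - B * X]sumsC mulr_sumr; apply: eq_bigr => r _.
  rewrite big_const card_unit /= addr0 /corr.
  rewrite (_ : (r%:Z, 0) - (0, 1) = (r%:Z, - 1%:Z)); first by ring.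
  by congr pair => /=; lia.
rewrite !big_const !card_unit /= !addr0 subrr (form_at0 H).
rewrite -/B => h.
nra.
Qed.

(** Scaling by [b i] moves (a, - b) to (a b, - 1), so the terms are values of
    [corr] at distinct arguments, and [bessel] controls their total deviation
    from the mean. *)
Lemma equidistribution {R : realFieldType} {delta : R} {m n : nat}
    {phi : int * int -> R} {I : finType} (P : pred I) (a b : I -> nat) :
  hyperbolic_form delta m phi -> 0 <= delta ->
  (0 < n)%N -> (#|P| <= 2 * n ^ 2 <= m)%N ->
  {in P &, injective (fun i => a i * b i)%N} ->
  (forall i, P i -> [&& 0 < b i, b i <= m & a i * b i < m]%N) ->
  `|\sum_(i | P i) phi ((a i)%:Z, - (b i)%:Z) - #|P|%:R * mean_corr phi m|
     <= 2 * n%:R + 1.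
Proof.
move=> H d0 n0 /andP[cP nm] inj bd.
set k := mean_corr phi m.
have m0 : (0 < m)%N by lia.
have mR : 0 < m%:R :> R by rewrite ltr0n.
have nR : 0 < n%:R :> R by rewrite ltr0n.
have cR : #|P|%:R <= 2 * n%:R ^+ 2 :> R by rewrite -natrX -natrM ler_nat.
have cm : #|P|%:R / m%:R <= 1 :> R by rewrite ler_pdivrMr // mul1r ler_nat; lia.
pose s r := corr phi r - k.
(* |s| <= (n s^2 + 1/n) / 2 replaces Cauchy-Schwarz; summed over at most 2 n^2
   indices with total square at most 2 it yields 2 n. *)
have step i : P i -> `|phi ((a i)%:Z, - (b i)%:Z) - k|
    <= (n%:R * s (a i * b i)%N ^+ 2 + n%:R^-1) / 2 + m%:R^-1.
  move=> Pi; have /and3P[b0 bm _] := bd i Pi.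
  have : (0 < b i <= m)%N by rewrite b0.
  move=> /(form_scale H _ (a i)%:Z (- 1%:Z)).
  rewrite mulrN1 -PoszM mulnC -/(corr phi (a i * b i)%N) => h.
  have : `|s (a i * b i)%N| <= (n%:R * s (a i * b i)%N ^+ 2 + n%:R^-1) / 2.
    have -> : s (a i * b i)%N ^+ 2 = `|s (a i * b i)%N| ^+ 2 by rewrite real_normK ?num_real.
    set x := `| _ |.
    have : 0 <= n%:R * (x - n%:R^-1) ^+ 2 by rewrite mulr_ge0 ?sqr_ge0 ?ler0n.
    have -> : n%:R * (x - n%:R^-1) ^+ 2 = n%:R * x ^+ 2 - 2 * x + n%:R^-1.
      by field; rewrite gt_eqF.
    by lra.
  rewrite /s; move: h; set u := phi _; set w := corr _ _ => h1 h2.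
  rewrite (_ : u - k = (w - k) - (w - u)); last by ring.
  by apply: le_trans (ler_normB _ _) _; lra.
pose o i : 'I_m := insubd (Ordinal m0) (a i * b i)%N.
have oE i : P i -> o i = (a i * b i)%N :> nat.
  by move=> /bd /and3P[_ _ lt_m]; rewrite /o val_insubd lt_m.
have sumP : \sum_(i | P i) s (a i * b i)%N ^+ 2 <= 2.
  apply: le_trans (bessel H d0 m0).
  have -> : \sum_(i | P i) s (a i * b i)%N ^+ 2 = \sum_(i | P i) s (o i) ^+ 2.
    by apply: eq_bigr => i Pi; rewrite oE.
  have oinj : {in P &, injective o}.
    by move=> i j Pi Pj /(congr1 val) /=; rewrite !oE //; apply: inj.
  rewrite -(big_imset (fun r : 'I_m => s r ^+ 2) oinj) /=.
  rewrite [leRHS](bigID (mem (o @: P)%SET)) /=.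
  by rewrite lerDl sumr_ge0 // => r _; exact: sqr_ge0.
rewrite -sum1_card natr_sum mulr_suml -sumrB.
under eq_bigr do rewrite mul1r.
apply: le_trans (ler_norm_sum _ _ _) _.
apply: le_trans (ler_sum _ step) _.
rewrite big_split /= -mulr_suml big_split /= -mulr_sumr !sumr_const
  -[n%:R^-1 *+ _]mulr_natr -[m%:R^-1 *+ _]mulr_natr.
have h1 : n%:R * (\sum_(i | P i) s (a i * b i)%N ^+ 2) <= n%:R * 2 by rewrite ler_pM2l.
have h2 : n%:R^-1 * #|P|%:R <= 2 * n%:R :> R.
  by rewrite mulrC ler_pdivrMr //; move: cR; rewrite expr2; lra.
rewrite mulrC in cm.
lra.
Qed.

(** The same for points of the open second and fourth quadrants, which evenness
    identifies. *)
Lemma equidistribution_points {R : realFieldType} {delta : R} {m n B : nat}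
    {phi : int * int -> R} {I : finType} (P : pred I) (q : I -> int * int) :
  hyperbolic_form delta m phi -> 0 <= delta ->
  (0 < n)%N -> (#|P| <= 2 * n ^ 2 <= m)%N -> (B ^ 2 < m)%N ->
  {in P &, injective (fun i => (q i).1 * (q i).2)} ->
  (forall i, P i ->
     [/\ (q i).1 * (q i).2 < 0, (absz (q i).1 <= B)%N & (absz (q i).2 <= B)%N]) ->
  `|\sum_(i | P i) phi (q i) - #|P|%:R * mean_corr phi m| <= 2 * n%:R + 1.
Proof.
move=> H d0 n0 cP Bm inj bd.
have -> : \sum_(i | P i) phi (q i)
    = \sum_(i | P i) phi ((absz (q i).1)%:Z, - (absz (q i).2)%:Z).
  apply: eq_bigr => i /bd [lt0 _ _]; case: (q i) lt0 => x y /= lt0.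
  have [x0|x0] := leP 0 x.
    by congr phi; congr pair; nia.
  by rewrite -(form_even H); congr phi; congr pair => /=; nia.
apply: equidistribution H d0 n0 cP _ _.
  move=> i j Pi Pj /= e; apply: inj => //.
  have [lti _ _] := bd i Pi; have [ltj _ _] := bd j Pj.
  nia.
move=> i /bd [lt0 l1 l2].
have : (absz (q i).1 * absz (q i).2 <= B * B)%N by exact: leq_mul.
have : (0 < absz (q i).2)%N.
  by rewrite absz_gt0; apply: contraTneq lt0 => ->; rewrite mulr0 ltxx.
by rewrite -mulnn in Bm; move: l2; nia.
Qed.

Lemma sum_offdiag {R : realFieldType} {N : nat} (j : 'I_N) (F : 'I_N -> R) :
  \sum_i F i = F j + \sum_(i < N | (i < j)%N) F i + \sum_(i < N | (j < i)%N) F i.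
Proof.
rewrite (bigD1 j) //= (bigID (fun i : 'I_N => (i < j)%N)) /= addrA.
congr (_ + _ + _); apply: eq_bigl => i; rewrite -val_eqE /=; lia.
Qed.

(** One row of the Gram matrix of a family of points.  The products are only
    required to be distinct on each side of the diagonal, since by symmetry they
    usually repeat across it. *)
Lemma row_sum {R : realFieldType} {delta : R} {m n B : nat}
    {phi : int * int -> R} (p : 'I_(2 * n ^ 2) -> int * int) :
  hyperbolic_form delta m phi -> 0 <= delta ->
  (0 < n)%N -> (2 * n ^ 2 <= m)%N -> (B ^ 2 < m)%N ->
  (forall i j : 'I_(2 * n ^ 2), (i < j)%N -> [/\ (p i - p j).1 * (p i - p j).2 < 0,
     (absz (p i - p j)%R.1 <= B)%N & (absz (p i - p j)%R.2 <= B)%N]) ->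
  (forall i i' j : 'I_(2 * n ^ 2), (i < i')%N -> (i' < j)%N || (j < i)%N ->
     (p i - p j).1 * (p i - p j).2 <> (p i' - p j).1 * (p i' - p j).2) ->
  forall j, \sum_i phi (p i - p j)
    <= (2 * n ^ 2)%N%:R * mean_corr phi m + 4 * n%:R + 3.
Proof.
move=> H d0 n0 nm Bm bd_lt ne j.
have bd i : i != j -> [/\ (p i - p j).1 * (p i - p j).2 < 0,
    (absz (p i - p j)%R.1 <= B)%N & (absz (p i - p j)%R.2 <= B)%N].
  rewrite -val_eqE; case: (ltngtP i j) => // lt _; first exact: bd_lt.
  by rewrite -opprB mulrNN !abszN; apply: bd_lt.
have k0 : 0 <= mean_corr phi m.
  by rewrite divr_ge0 ?ler0n // sumr_ge0 // => r _; apply: form_ge0 H _.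
have inj (P : pred 'I_(2 * n ^ 2)) :
    (forall i i', P i -> P i' -> (i < i')%N -> (i' < j)%N || (j < i)%N) ->
    {in P &, injective (fun i => (p i - p j).1 * (p i - p j).2)}.
  move=> hP i i' Pi Pi' /= e; case: (ltngtP i i') => [lt|lt|/val_inj //].
    by case: (ne i i' j lt (hP _ _ Pi Pi' lt)).
  by case: (ne i' i j lt (hP _ _ Pi' Pi lt)).
have cP (P : pred 'I_(2 * n ^ 2)) : (#|P| <= 2 * n ^ 2 <= m)%N.
  by rewrite nm andbT; apply: leq_trans (max_card _) _; rewrite card_ord.
pose lo_set := [pred i : 'I_(2 * n ^ 2) | (i < j)%N].
pose hi_set := [pred i : 'I_(2 * n ^ 2) | (j < i)%N].
have lo : `|\sum_(i | lo_set i) phi (p i - p j) - #|lo_set|%:R * mean_corr phi m|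
    <= 2 * n%:R + 1.
  apply: (equidistribution_points lo_set (fun i => p i - p j) H d0 n0 (cP _) Bm).
    by apply: inj => i i' _ lt _; apply/orP; left.
  by move=> i lt; apply: bd; rewrite -val_eqE /=; move: lt; rewrite /lo_set /=; lia.
have hi : `|\sum_(i | hi_set i) phi (p i - p j) - #|hi_set|%:R * mean_corr phi m|
    <= 2 * n%:R + 1.
  apply: (equidistribution_points hi_set (fun i => p i - p j) H d0 n0 (cP _) Bm).
    by apply: inj => i i' lt _ _; apply/orP; right.
  by move=> i lt; apply: bd; rewrite -val_eqE /=; move: lt; rewrite /hi_set /=; lia.
have card : (2 * n ^ 2)%N%:R = 1 + #|lo_set|%:R + #|hi_set|%:R :> R.
  have := sum_offdiag j (fun=> 1 : R).
  by rewrite !sumr_const card_ord.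
rewrite (sum_offdiag j) subrr (form_at0 H) card.
move: lo hi; rewrite !ler_norml => /andP[_ lo] /andP[_ hi].
lra.
Qed.

(** * Comparing points of the hyperbola with a remote family *)
Definition hyperbola_point (N j : nat) : int * int :=
  ((2 ^ j)%N%:Z, (2 ^ (2 * N - j))%N%:Z).

(** Each far point lies to the upper left of the origin, of all points
    [hyperbola_point N j] with [j < N] and of its predecessors, so that the
    differences have coordinates of opposite signs. *)
Definition far_point (N i : nat) : int * int :=
  (- i.+1%:Z, (2 ^ (2 * N) + i.+1)%N%:Z).

(** Bounds every coordinate of every difference considered. *)
Definition point_bound (N : nat) : nat := (2 ^ (2 * N) + 2 * N + 2)%N.

Lemma hyperbola_point_mono (N i j : nat) : (i < j <= 2 * N)%N ->
  [/\ (2 ^ i < 2 ^ j)%N, (2 ^ j <= 2 ^ (2 * N))%N,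
      (2 ^ (2 * N - j) < 2 ^ (2 * N - i))%N
    & (2 ^ (2 * N - i) <= 2 ^ (2 * N))%N].
Proof.
by move=> h; rewrite !ltn_exp2l ?leq_exp2l //; split => //; lia.
Qed.

(** The area of the box spanned with a fixed corner is monotone; this separates
    the products of differences of [hyperbola_point]s. *)
Lemma corner_lt (x x' X y y' Y : nat) :
  (x < x' < X)%N -> (Y < y' < y)%N ->
  (x%:Z - X%:Z) * (y%:Z - Y%:Z) < (x'%:Z - X%:Z) * (y'%:Z - Y%:Z).
Proof.
move=> hx hy; rewrite -subr_gt0.
have -> : (x'%:Z - X%:Z) * (y'%:Z - Y%:Z) - (x%:Z - X%:Z) * (y%:Z - Y%:Z)
  = (x'%:Z - x%:Z) * (y%:Z - Y%:Z) + (X%:Z - x'%:Z) * (y%:Z - y'%:Z) by ring.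
by rewrite addr_gt0 // mulr_gt0 //; lia.
Qed.

Lemma hyperbola_rows {R : realFieldType} {delta : R} {m n : nat}
    {phi : int * int -> R} (N := (2 * n ^ 2)%N) :
  hyperbolic_form delta m phi -> 0 <= delta ->
  (0 < n)%N -> (N <= m)%N -> (point_bound N ^ 2 < m)%N ->
  forall j : 'I_N, \sum_(i < N) phi (hyperbola_point N i - hyperbola_point N j)
    <= N%:R * mean_corr phi m + 4 * n%:R + 3.
Proof.
move=> H d0 n0 nm Bm j.
apply: (row_sum (fun i : 'I_N => hyperbola_point N i) H d0 n0 nm Bm) => {j}.
  move=> i j lt; have := @hyperbola_point_mono N i j.
  have -> : (i < j <= 2 * N)%N by have := ltn_ord j; lia.
  move=> /(_ isT); rewrite /point_bound /=.
  move: (2 ^ i)%N (2 ^ j)%N (2 ^ (2 * N - i))%N (2 ^ (2 * N - j))%N.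
  move: (2 ^ (2 * N))%N => M x X y Y [? ? ? ?]; split; [|lia|lia].
  by rewrite nmulr_rlt0; lia.
move=> i i' j lt; have := @hyperbola_point_mono N i i'.
have -> : (i < i' <= 2 * N)%N by have := ltn_ord i'; lia.
move=> /(_ isT) hi /orP[] lt'.
  have := @hyperbola_point_mono N i' j.
  have -> : (i' < j <= 2 * N)%N by have := ltn_ord j; lia.
  move=> /(_ isT) [? ? ? ?]; case: hi => ? ? ? ?.
  by apply/eqP; rewrite lt_eqF //=; apply: corner_lt; apply/andP.
have := @hyperbola_point_mono N j i.
have -> : (j < i <= 2 * N)%N by have := ltn_ord i; lia.
move=> /(_ isT) [? ? ? ?]; case: hi => ? ? ? ?.
apply/eqP; rewrite gt_eqF //= ![_ * (_ - Posz (2 ^ (2 * N - j)))]mulrC.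
by apply: corner_lt; apply/andP.
Qed.

Lemma far_rows {R : realFieldType} {delta : R} {m n : nat}
    {phi : int * int -> R} (N := (2 * n ^ 2)%N) :
  hyperbolic_form delta m phi -> 0 <= delta ->
  (0 < n)%N -> (N <= m)%N -> (point_bound N ^ 2 < m)%N ->
  forall j : 'I_N, \sum_(i < N) phi (far_point N i - far_point N j)
    <= N%:R * mean_corr phi m + 4 * n%:R + 3.
Proof.
move=> H d0 n0 nm Bm j.
apply: (row_sum (fun i : 'I_N => far_point N i) H d0 n0 nm Bm) => {j}.
  move=> i j; have := ltn_ord i; have := ltn_ord j.
  rewrite /point_bound /= -/N; move: (2 ^ (2 * N))%N => M ? ? ?.
  by split; nia.
have coord (i j : 'I_N) : far_point N i - far_point N j
    = (j%:Z - i%:Z, i%:Z - j%:Z) :> (int * int)%type.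
  by congr pair => /=; lia.
move=> i i' j lt lt'; rewrite !coord /=; apply/eqP; rewrite -subr_eq0.
rewrite (_ : _ - _ = (i'%:Z - i%:Z) * (i'%:Z + i%:Z - 2 * j%:Z)); last by ring.
by rewrite mulf_neq0 //; lia.
Qed.

Lemma far_lt (i i' x y M : nat) : (i < i')%N -> (y <= M)%N ->
  (- i'.+1%:Z - x%:Z) * ((M + i'.+1)%N%:Z - y%:Z)
    < (- i.+1%:Z - x%:Z) * ((M + i.+1)%N%:Z - y%:Z).
Proof.
move=> lt le; rewrite -subr_gt0 !PoszD.
have -> : (- i.+1%:Z - x%:Z) * (M%:Z + i.+1%:Z - y%:Z)
    - (- i'.+1%:Z - x%:Z) * (M%:Z + i'.+1%:Z - y%:Z)
  = (i'.+1%:Z - i.+1%:Z) * (M%:Z - y%:Z + i.+1%:Z + i'.+1%:Z + x%:Z) by ring.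
by rewrite mulr_gt0 //; lia.
Qed.

(** The point [(x, y)] is to be a point of the hyperbola or the origin. *)
Lemma far_mean {R : realFieldType} {delta : R} {m n : nat}
    {phi : int * int -> R} (N := (2 * n ^ 2)%N) (x y : nat) :
  hyperbolic_form delta m phi -> 0 <= delta ->
  (0 < n)%N -> (N <= m)%N -> (point_bound N ^ 2 < m)%N ->
  (x <= 2 ^ (2 * N))%N -> (y <= 2 ^ (2 * N))%N ->
  N%:R * mean_corr phi m - (2 * n%:R + 1)
    <= \sum_(i < N) phi (far_point N i - (x%:Z, y%:Z)).
Proof.
move=> H d0 n0 nm Bm xM yM.
have := @equidistribution_points R delta m n _ phi _ (@predT 'I_N)
  (fun i : 'I_N => far_point N i - (x%:Z, y%:Z)) H d0 n0 _ Bm.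
rewrite card_ord leqnn nm => /(_ isT) h.
suff : `|\sum_(i < N) phi (far_point N i - (x%:Z, y%:Z))
          - N%:R * mean_corr phi m| <= 2 * n%:R + 1.
  by rewrite ler_norml => /andP[+ _]; lra.
apply: h => [i i' _ _ /= e|i _ /=].
  apply: val_inj; case: (ltngtP i i') => // lt.
    by have := far_lt i i' x y _ lt yM; rewrite e ltxx.
  by have := far_lt i' i x y _ lt yM; rewrite e ltxx.
have := ltn_ord i; rewrite /point_bound => iN; split; [|lia|lia].
by rewrite nmulr_rlt0; lia.
Qed.

Lemma form_density_le1 {R : realFieldType} {delta : R} {m : nat}
    {phi : int * int -> R} : hyperbolic_form delta m phi -> delta <= 1.
Proof.
move=> H; have := form_psd H unit (fun=> 1) (fun=> 0).
rewrite !big_const !card_unit /= !addr0 (form_at0 H).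
by rewrite expr1n !mulr1.
Qed.

(** Write V and Z for the sums of the vectors of the hyperbola points and of the
    far points, and o for the vector of the origin.  The row estimates give
    |V - Z|^2 <= 20 n N, while <Z, o> is about N kappa, hence of order delta N
    since |Z|^2 >= delta N^2.  If <V, o> <= 0 then |V - Z + c o|^2 would be
    negative for c = delta N / 2 once n is large compared with delta^-2. *)
Theorem hyperbola_recurrence {R : realFieldType} {delta : R} {m n : nat}
    {phi : int * int -> R} (N := (2 * n ^ 2)%N) :
  hyperbolic_form delta m phi -> 0 < delta -> 40 < n%:R * delta ^+ 2 ->
  (N <= m)%N -> (point_bound N ^ 2 < m)%N ->
  exists j : 'I_N, 0 < phi (hyperbola_point N j).
Proof.
move=> H d0 n_big Nm Bm.
have d1 := form_density_le1 H.
have n0 : (0 < n)%N.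
  by move: n_big; case: n @N Nm Bm => // N _ _; rewrite mul0r => ?; lra.
have nR : 1 <= n%:R :> R by rewrite ler1n.
case: (pselect (exists j : 'I_N, 0 < phi (hyperbola_point N j))) => // none.
have miss : \sum_(j < N) phi (hyperbola_point N j) <= 0.
  apply: sumr_le0 => j _; rewrite leNgt; apply/negP => lt.
  by apply: none; exists j.
set k := mean_corr phi m.
set X := N%:R : R.
have XE : X = 2 * n%:R ^+ 2 by rewrite /X /N natrM natrX.
pose v (j : 'I_N) := hyperbola_point N j.
pose z (j : 'I_N) := far_point N j.
have le_exp (j : 'I_N) : (2 ^ j <= 2 ^ (2 * N))%N && (2 ^ (2 * N - j) <= 2 ^ (2 * N))%N.
  by rewrite !leq_exp2l //; have := ltn_ord j; lia.
have total (F : 'I_N -> R) c : (forall j, F j <= c) -> \sum_j F j <= X * c.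
  move=> h; apply: le_trans (ler_sum _ (fun j _ => h j)) _.
  by rewrite sumr_const card_ord -mulr_natl.
have vv : \sum_i \sum_j phi (v i - v j) <= X * (X * k + 4 * n%:R + 3).
  by rewrite exchange_big; apply: total; apply: hyperbola_rows H (ltW d0) n0 Nm Bm.
have zz : \sum_i \sum_j phi (z i - z j) <= X * (X * k + 4 * n%:R + 3).
  by rewrite exchange_big; apply: total; apply: far_rows H (ltW d0) n0 Nm Bm.
have vz : X * (X * k - (2 * n%:R + 1)) <= \sum_i \sum_j phi (v i - z j).
  rewrite -lerN2 -mulrN -sumrN; apply: total => j; rewrite lerN2.
  under eq_bigr do rewrite -(form_even H) opprB.
  by have /andP[? ?] := le_exp j; apply: far_mean H (ltW d0) n0 Nm Bm _ _.
have z0 : X * k - (2 * n%:R + 1) <= \sum_j phi (z j).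
  have := @far_mean _ _ _ _ _ 0 0 H (ltW d0) n0 Nm Bm isT isT.
  by rewrite (eq_bigr (fun j => phi (z j))) // => j _; congr phi; exact: subr0.
have dens : delta * X ^+ 2 <= \sum_i \sum_j phi (z i - z j).
  have := form_psd H 'I_N (fun=> 1) z.
  rewrite sumr_const card_ord -/X.
  by under eq_bigr do under eq_bigr do rewrite !mul1r.
have form (c : R) : 0 <= \sum_i \sum_j phi (v i - v j) - 2 * (\sum_i \sum_j phi (v i - z j))
   + \sum_i \sum_j phi (z i - z j) + 2 * c * (\sum_j phi (v j) - \sum_j phi (z j)) + c ^+ 2.
  pose P (x : 'I_N + 'I_N) := match x with inl i => v i | inr j => z j end.
  pose C (x : 'I_N + 'I_N) : R := match x with inl i => 1 | inr j => - 1 end.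
  have := form_split C (fun _ : unit => c) P (fun=> 0) H (ltW d0).
  have neg (F : 'I_N -> 'I_N -> R) : \sum_i \sum_j - F i j = - \sum_i \sum_j F i j.
    by rewrite -sumrN; apply: eq_bigr => i _; rewrite sumrN.
  have -> : \sum_x \sum_y C x * C y * phi (P x - P y)
    = \sum_i \sum_j phi (v i - v j) - 2 * (\sum_i \sum_j phi (v i - z j))
      + \sum_i \sum_j phi (z i - z j).
    rewrite big_sumType /=.
    under eq_bigr do rewrite big_sumType /=.
    under [X in _ + X]eq_bigr do rewrite big_sumType /=.
    rewrite !big_split /=.
    have -> : \sum_i \sum_j -1 * 1 * phi (z i - v j) = - \sum_i \sum_j phi (v i - z j).
      rewrite exchange_big -neg; apply: eq_bigr => i _; apply: eq_bigr => j _ /=.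
      by rewrite -(form_even H) opprB; ring.
    have -> : \sum_i \sum_j 1 * -1 * phi (v i - z j) = - \sum_i \sum_j phi (v i - z j).
      by rewrite -neg; apply: eq_bigr => i _; apply: eq_bigr => j _; ring.
    have -> : \sum_i \sum_j -1 * -1 * phi (z i - z j) = \sum_i \sum_j phi (z i - z j).
      by apply: eq_bigr => i _; apply: eq_bigr => j _; ring.
    have -> : \sum_i \sum_j 1 * 1 * phi (v i - v j) = \sum_i \sum_j phi (v i - v j).
      by apply: eq_bigr => i _; apply: eq_bigr => j _; ring.
    by ring.
  have -> : \sum_x \sum_(y : unit) C x * c * phi (P x - 0)
    = c * (\sum_j phi (v j) - \sum_j phi (z j)).
    rewrite big_sumType /= mulrBr !mulr_sumr -sumrN.
    congr (_ + _); apply: eq_bigr => i _;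
    by rewrite big_const card_unit /= addr0 subr0; ring.
  rewrite !big_const !card_unit /= !addr0 (form_at0 H).
  by move=> h; apply: le_trans h _; lra.
have XR : 2 <= X by rewrite XE; nra.
have kd : delta * X <= X * k + 4 * n%:R + 3.
  have X0 : 0 < X by lra.
  rewrite -(ler_pM2l X0) (_ : X * (delta * X) = delta * X ^+ 2) //; last by ring.
  lra.
have w0 : delta * X - 10 * n%:R <= \sum_j phi (z j) by lra.
have nd : 40 < n%:R * delta by nra.
have half : delta * X / 2 <= \sum_j phi (z j).
  by apply: le_trans w0; rewrite XE; nra.
have := form (delta * X / 2); set V0 := \sum_j phi (v j); set Z0 := \sum_j phi (z j).
have x0 : 0 <= delta * X / 2 by rewrite divr_ge0 // mulr_ge0 //; lra.
have gain : 2 * (delta * X / 2) * (V0 - Z0) <= - 2 * (delta * X / 2) ^+ 2.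
  have : (delta * X / 2) * (V0 - Z0) <= (delta * X / 2) * - (delta * X / 2).
    by apply: ler_wpM2l => //; move: half miss; rewrite -/V0 -/Z0; lra.
  by lra.
have cost : X * (12 * n%:R + 8) <= X * (20 * n%:R) by rewrite ler_pM2l; lra.
have : X * (80 * n%:R) < X * (delta ^+ 2 * X).
  by rewrite ltr_pM2l; [rewrite XE; nra|lra].
lra.
Qed.

(** * Averaged autocorrelations *)
Definition autocorr {R : realFieldType} {G : finZmodType} (A : {pred G}) (x : G) : R :=
  \sum_z (z \in A)%:R * (z + x \in A)%:R.

(** Exponents are indexed redundantly by all integers up to [m], not by primes:
    raising the exponent of [n] by one multiplies the product by [n], which is
    all that is needed of a multiplicative Folner sequence. *)
Definition smooth {m : nat} (e : 'I_m -> nat) : nat := \prod_(i < m) i.+1 ^ e i.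

(** The exponent 2 m leaves room for [e] to be raised once beyond its range and
    makes the product of the two factors a perfect square. *)
Definition dilation {m : nat} (e : 'I_m -> nat) (p : int * int) : int * int :=
  (p.1 * (smooth e)%:Z, p.2 * (smooth (fun i => 2 * m - e i)%N)%:Z).

Definition averaged_corr {R : realFieldType} {G : finZmodType}
    (pi : {additive int * int -> G}) (A : {pred G}) (m : nat) (p : int * int) : R :=
  (\sum_(e : {ffun 'I_m -> 'I_m})
     autocorr A (pi (dilation (fun i => e i) p)))
  / (#|{ffun 'I_m -> 'I_m}|%:R * #|A|%:R).

Lemma autocorr_ge0 {R : realFieldType} {G : finZmodType} (A : {pred G}) (x : G) :
  0 <= autocorr A x :> R.
Proof. by apply: sumr_ge0 => z _; rewrite mulr_ge0. Qed.

Lemma autocorr_le {R : realFieldType} {G : finZmodType} (A : {pred G}) (x : G) :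
  autocorr A x <= #|A|%:R :> R.
Proof.
rewrite -sum1_card natr_sum [leRHS]big_mkcond; apply: ler_sum => z _ /=.
by case: (z \in A); case: (_ \in A); rewrite ?mul1r ?mul0r.
Qed.

Lemma autocorr0 {R : realFieldType} {G : finZmodType} (A : {pred G}) :
  autocorr A 0 = #|A|%:R :> R.
Proof.
rewrite -sum1_card natr_sum [RHS]big_mkcond; apply: eq_bigr => z _ /=.
by rewrite addr0; case: (z \in A); rewrite ?mul1r ?mul0r.
Qed.

Lemma autocorrN {R : realFieldType} {G : finZmodType} (A : {pred G}) (x : G) :
  autocorr A (- x) = autocorr A x :> R.
Proof.
rewrite [RHS](reindex_inj (addIr (- x))); apply: eq_bigr => z _.
by rewrite mulrC subrK.
Qed.

Lemma autocorrB {R : realFieldType} {G : finZmodType} (A : {pred G}) (x y : G) :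
  autocorr A (x - y) = \sum_z (z + x \in A)%:R * (z + y \in A)%:R :> R.
Proof.
rewrite /autocorr (reindex_inj (addIr y)); apply: eq_bigr => z _.
by rewrite mulrC (addrC x) addrA addrK.
Qed.

Lemma sqr_sum_le {R : realFieldType} {I : finType} (F : I -> R) :
  (\sum_i F i) ^+ 2 <= #|I|%:R * \sum_i F i ^+ 2.
Proof.
have : 0 <= \sum_i \sum_j (F i - F j) ^+ 2.
  by apply: sumr_ge0 => i _; apply: sumr_ge0 => j _; exact: sqr_ge0.
have -> : \sum_i \sum_j (F i - F j) ^+ 2
    = 2 * (#|I|%:R * \sum_i F i ^+ 2) - 2 * (\sum_i F i) ^+ 2; last by lra.
have row i : \sum_j (F i - F j) ^+ 2
    = #|I|%:R * F i ^+ 2 + \sum_j F j ^+ 2 - 2 * (\sum_j F j) * F i.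
  transitivity (\sum_j (F i ^+ 2 + F j ^+ 2 - 2 * F i * F j)).
    by apply: eq_bigr => j _; ring.
  by rewrite sumrB big_split /= sumr_const -mulr_sumr -[_ *+ #|_|]mulr_natl; ring.
under eq_bigr do rewrite row.
rewrite sumrB big_split /= sumr_const -!mulr_sumr -[_ *+ #|_|]mulr_natl.
by ring.
Qed.

(** The double sum is the squared l^2 norm of a combination of translates of the
    indicator function of [A]; Cauchy-Schwarz against the constant function 1
    bounds it below. *)
Lemma autocorr_psd {R : realFieldType} {G : finZmodType} (A : {pred G})
    {I : finType} (c : I -> R) (x : I -> G) :
  #|A|%:R ^+ 2 * (\sum_i c i) ^+ 2
    <= #|G|%:R * \sum_i \sum_j c i * c j * autocorr A (x i - x j).
Proof.
have -> : \sum_i \sum_j c i * c j * autocorr A (x i - x j)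
    = \sum_z (\sum_i c i * (z + x i \in A)%:R) ^+ 2.
  under [RHS]eq_bigr do rewrite expr2 mulr_suml.
  rewrite [RHS]exchange_big /=; apply: eq_bigr => i _.
  under [RHS]eq_bigr do rewrite mulr_sumr.
  rewrite [RHS]exchange_big /=; apply: eq_bigr => j _.
  by rewrite autocorrB mulr_sumr; apply: eq_bigr => z _; ring.
apply: le_trans (sqr_sum_le _).
rewrite -exprMn exchange_big /= mulr_sumr le_eqVlt; apply/orP; left; apply/eqP.
congr (_ ^+ 2); apply: eq_bigr => i _.
rewrite -mulr_sumr mulrC; congr (_ * _).
rewrite -sum1_card natr_sum big_mkcond (reindex_inj (addIr (x i))) /=.
by apply: eq_bigr => z _; case: (_ \in A).
Qed.

Lemma dilationB {m : nat} (e : 'I_m -> nat) (p q : int * int) :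
  dilation e (p - q) = dilation e p - dilation e q.
Proof. by congr pair => /=; rewrite mulrBl. Qed.

Lemma smooth_scale {m : nat} (i0 : 'I_m) (e : 'I_m -> nat) :
  smooth (fun i => e i + (i == i0))%N = (i0.+1 * smooth e)%N.
Proof.
rewrite /smooth; under eq_bigr do rewrite expnD.
rewrite big_split /= mulnC; congr (_ * _)%N.
rewrite (bigD1 i0) //= eqxx expn1 big1 ?muln1 // => i /negbTE ->.
by rewrite expn0.
Qed.

Lemma smooth_dual {m : nat} (e : {ffun 'I_m -> 'I_m}) :
  (smooth (fun i => e i) * smooth (fun i => 2 * m - e i) = (m`! ^ m) ^ 2)%N.
Proof.
rewrite /smooth -big_split /= -expnM (mulnC m) fact_prod big_add1 big_mkord.
rewrite (big_morph (fun x => x ^ (2 * m))%N (fun x y => expnMn x y _) (exp1n _)).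
apply: eq_bigr => i _; rewrite -expnD subnKC //.
by have := ltn_ord (e i); lia.
Qed.

Lemma card_fix_exponent {m : nat} (i0 k : 'I_m) :
  (m * #|[pred e : {ffun 'I_m -> 'I_m} | e i0 == k]|
    = #|{ffun 'I_m -> 'I_m}|)%N.
Proof.
pose F (i : 'I_m) : pred 'I_m := if i == i0 then pred1 k else predT.
have -> : #|[pred e : {ffun 'I_m -> 'I_m} | e i0 == k]| = #|family F|.
  apply: eq_card => e; rewrite !inE; apply/eqP/familyP => [ei0 i|/(_ i0)].
    by rewrite /F; case: (i =P i0) => [->|_]; rewrite inE // ei0.
  by rewrite /F eqxx inE => /eqP.
rewrite card_family foldrE big_image (bigD1 i0) //= /F eqxx card1 mul1n.
rewrite card_ffun card_ord (eq_bigr (fun=> m)) => [|i /negbTE ->]; last first.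
  by rewrite -[RHS]card_ord; apply: eq_card.
have -> : (m ^ m = \prod_(i < m) m)%N by rewrite prod_nat_const card_ord.
by rewrite [RHS](bigD1 i0).
Qed.

(** For the scaling property, both averages are sums of one function [h] over
    exponent vectors: over [e] for phi (a, n b), and over [e] with the exponent
    of [n] raised by one for phi (n a, b).  Raising that exponent cyclically is a
    permutation, so only the vectors where it is maximal contribute to the
    difference, and they form a fraction 1 / m of all. *)
Lemma averaged_corr_form {R : realFieldType} {G : finZmodType}
    (pi : {additive int * int -> G}) (A : {pred G}) (m : nat) :
  (0 < m)%N -> (0 < #|A|)%N ->
  hyperbolic_form (#|A|%:R / #|G|%:R : R) m (averaged_corr pi A m).
Proof.
move=> m0 A0.
have AR : 0 < #|A|%:R :> R by rewrite ltr0n.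
have E0 : (0 < #|{ffun 'I_m -> 'I_m}|)%N by rewrite card_ffun expn_gt0 card_ord m0.
have ER : 0 < #|{ffun 'I_m -> 'I_m}|%:R :> R by rewrite ltr0n.
have GR : 0 < #|G|%:R :> R by rewrite ltr0n; apply/card_gt0P; exists 0.
split.
- rewrite /averaged_corr.
  under eq_bigr do rewrite /dilation !mul0r raddf0 autocorr0.
  by rewrite sumr_const -[_ *+ _]mulr_natl divff // mulf_neq0 // gt_eqF.
- move=> p; rewrite divr_ge0 ?mulr_ge0 ?ler0n // sumr_ge0 // => e _.
  exact: autocorr_ge0.
- move=> p; congr (_ / _); apply: eq_bigr => e _.
  by rewrite -[RHS]autocorrN -raddfN; congr (autocorr A (pi _)); congr pair => /=;
     rewrite mulNr.
- move=> I c p; rewrite /averaged_corr.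
  pose X (e : {ffun 'I_m -> 'I_m}) i := pi (dilation (fun k => e k) (p i)).
  pose Y e : R := \sum_i \sum_j c i * c j * autocorr A (X e i - X e j).
  have -> : \sum_i \sum_j c i * c j * averaged_corr pi A m (p i - p j)
      = (\sum_e Y e) / (#|{ffun 'I_m -> 'I_m}|%:R * #|A|%:R).
    rewrite exchange_big mulr_suml /=.
    rewrite [RHS](eq_bigr (fun e => \sum_j \sum_i c i * c j
        * autocorr A (X e i - X e j) / (#|{ffun 'I_m -> 'I_m}|%:R * #|A|%:R))).
      rewrite [RHS]exchange_big /=; apply: eq_bigr => j _.
      rewrite [RHS]exchange_big /=; apply: eq_bigr => i _.
      rewrite mulrA mulr_sumr mulr_suml; apply: eq_bigr => e _.
      by rewrite dilationB raddfB.
    move=> e _; rewrite /Y exchange_big mulr_suml; apply: eq_bigr => j _.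
    by rewrite mulr_suml.
  rewrite ler_pdivlMr ?mulr_gt0 // -(ler_pM2l GR) mulr_sumr.
  have low e : #|A|%:R ^+ 2 * (\sum_i c i) ^+ 2 <= #|G|%:R * Y e.
    exact: autocorr_psd.
  apply: le_trans (ler_sum _ (fun e _ => low e)).
  rewrite sumr_const -[_ *+ #|_|]mulr_natl le_eqVlt; apply/orP; left; apply/eqP.
  by field; rewrite gt_eqF.
- move=> n a b /andP[n0 nm].
  have lastP : (m.-1 < m)%N by lia.
  have i0P : (n.-1 < m)%N by lia.
  pose i0 := Ordinal i0P.
  have nE : n = i0.+1 by rewrite /=; lia.
  pose h (e : 'I_m -> nat) : R := autocorr A (pi (dilation e (a, n%:Z * b))).
  pose next (e : {ffun 'I_m -> 'I_m}) : {ffun 'I_m -> 'I_m} :=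
    [ffun i => if i == i0 then ordS (e i) else e i].
  have next_inj : injective next.
    move=> e e' /ffunP eq_next; apply/ffunP => i; have := eq_next i.
    by rewrite !ffunE; case: (i == i0) => // /ordS_inj.
  pose up (e : {ffun 'I_m -> 'I_m}) i := (e i + (i == i0))%N.
  have lhs (e : {ffun 'I_m -> 'I_m}) : 
      autocorr A (pi (dilation (fun i => e i) (n%:Z * a, b))) = h (up e).
    congr (autocorr A (pi _)); rewrite /dilation /=; congr pair.
      by rewrite smooth_scale -nE PoszM; ring.
    have -> : smooth (fun i => 2 * m - e i)%N = (n * smooth (fun i => 2 * m - up e i))%N.
      rewrite nE -smooth_scale; apply: eq_bigr => i _; congr (_ ^ _)%N.
      by rewrite /up; have := ltn_ord (e i); case: (i == i0); lia.
    by rewrite PoszM; ring.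
  rewrite /averaged_corr -mulrBl.
  under eq_bigr do rewrite lhs.
  rewrite [X in _ - X](reindex_inj next_inj) /= -sumrB.
  pose last := [pred e : {ffun 'I_m -> 'I_m} | e i0 == Ordinal lastP].
  have -> : \sum_e (h (up e) - h (fun i => next e i))
      = \sum_(e | last e) (h (up e) - h (fun i => next e i)).
    rewrite [RHS]big_mkcond; apply: eq_bigr => e _.
    case: ifP => //= /negbT; rewrite -val_eqE /= => not_last.
    apply/eqP; rewrite subr_eq0; apply/eqP; congr h; apply: funext => i.
    rewrite /up ffunE; case: eqP => [->|_]; rewrite ?addn0 ?addn1 //=.
    rewrite modn_small //; have := ltn_ord (e i0); move: not_last.
    by move: (nat_of_ord (e i0)) => k; lia.
  rewrite normrM [X in _ * X]ger0_norm ?invr_ge0 ?mulr_ge0 ?ler0n //.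
  rewrite ler_pdivrMr ?mulr_gt0 //.
  apply: le_trans (ler_norm_sum _ _ _) _.
  have bound e : last e -> `|h (up e) - h (fun i => next e i)| <= #|A|%:R.
    move=> _; rewrite ler_norml.
    have := @autocorr_ge0 R G A (pi (dilation (up e) (a, n%:Z * b))).
    have := @autocorr_ge0 R G A (pi (dilation (fun i => next e i) (a, n%:Z * b))).
    have := @autocorr_le R G A (pi (dilation (up e) (a, n%:Z * b))).
    have := @autocorr_le R G A (pi (dilation (fun i => next e i) (a, n%:Z * b))).
    by rewrite -/(h (up e)) -/(h _); lra.
  apply: le_trans (ler_sum _ bound) _.
  rewrite sumr_const -[_ *+ #|_|]mulr_natl.
  rewrite -(card_fix_exponent i0 (Ordinal lastP)) natrM.
  rewrite le_eqVlt; apply/orP; left; apply/eqP; field.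
  by rewrite gt_eqF // ltr0n.
Qed.

Lemma averaged_corr_hit {R : realFieldType} {G : finZmodType}
    (pi : {additive int * int -> G}) (A : {pred G}) (m : nat) (p : int * int) :
  0 < averaged_corr pi A m p :> R ->
  exists (e : {ffun 'I_m -> 'I_m}) (z : G),
    z \in A /\ z + pi (dilation (fun i => e i) p) \in A.
Proof.
move=> pos; apply: contrapT => none; move: pos.
rewrite /averaged_corr big1 ?mul0r ?ltxx // => e _.
rewrite /autocorr big1 // => z _.
case zA: (z \in A); case xA : (_ \in A); rewrite ?mul0r ?mulr0 //.
by case: none; exists e, z.
Qed.

(** * From the plane to a torus *)
HB.instance Definition _ (U V : finZmodType) := GRing.Zmodule.on (U * V)%type.

Definition residue (M : nat) (p : int * int) : 'Z_M * 'Z_M := (p.1%:~R, p.2%:~R).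

Lemma residue_is_zmod_morphism (M : nat) : zmod_morphism (residue M).
Proof. by move=> p q; rewrite /residue /= !intrB. Qed.

HB.instance Definition _ (M : nat) :=
  GRing.isZmodMorphism.Build (int * int)%type ('Z_M * 'Z_M)%type (residue M)
    (residue_is_zmod_morphism M).

(** The change of coordinates under which x^2 - y^2 becomes 4 u v. *)
Definition from_null_coords (p : int * int) : int * int := (p.1 + p.2, p.2 - p.1).

Lemma from_null_coords_is_zmod_morphism : zmod_morphism from_null_coords.
Proof. by move=> p q; congr pair => /=; ring. Qed.

HB.instance Definition _ :=
  GRing.isZmodMorphism.Build (int * int)%type (int * int)%type from_null_coords
    from_null_coords_is_zmod_morphism.

Lemma intZp_eq0 (M : nat) (x : int) : (1 < M)%N -> (absz x < M)%N ->
  x%:~R = 0 :> 'Z_M -> x = 0.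
Proof.
move=> M1; have nat_case (k : nat) : (k < M)%N -> k%:R = 0 :> 'Z_M -> k = 0%N.
  by move=> kM /(congr1 val) /=; rewrite val_Zp_nat // modn_small.
case: x => k kM; first by move=> /nat_case -> //.
rewrite NegzE mulrNz => /eqP; rewrite oppr_eq0 => /eqP /nat_case.
by move=> /(_ kM).
Qed.

Lemma residue_eq0 (M : nat) (p : int * int) :
  (absz p.1 < M)%N -> (absz p.2 < M)%N -> (1 < M)%N -> residue M p = 0 -> p = 0.
Proof.
move=> p1 p2 M1 [/(intZp_eq0 _ _ M1 p1) e1 /(intZp_eq0 _ _ M1 p2) e2].
by case: p e1 e2 {p1 p2} => x y /= -> ->.
Qed.

Definition box_points (E : set (int * int)) (q : nat) : seq (int * int) :=
  finmap.enum_fset (fset_set (E `&` box q)).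

Lemma mem_box_points (E : set (int * int)) (q : nat) (p : int * int) :
  (p \in box_points E q) = (p \in E `&` box q).
Proof.
by rewrite /box_points in_fset_set //; apply: sub_finite_set (finite_box q); exact: subIsetr.
Qed.

Lemma card_residues (E : set (int * int)) (q M : nat) :
  (2 * q + 1 < M)%N ->
  #|[seq residue M p | p <- box_points E q]| = size (box_points E q).
Proof.
move=> qM; rewrite -(size_map (residue M)); apply/card_uniqP.
rewrite map_inj_in_uniq ?finmap.fset_uniq // => -[x y] [x' y'].
rewrite !mem_box_points => /set_mem [_ [/= p1 p2]] /set_mem [_ [/= p1' p2']] e.
apply/eqP; rewrite -subr_eq0; apply/eqP; apply: (residue_eq0 M).
- by rewrite /=; lia.
- by rewrite /=; lia.
- by lia.
- by apply/eqP; rewrite raddfB subr_eq0; apply/eqP.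
Qed.

Lemma card_torus (M : nat) : (1 < M)%N -> #|{: 'Z_M * 'Z_M}| = (M ^ 2)%N.
Proof. by move=> M1; rewrite card_prod card_ord Zp_cast // mulnn. Qed.

(** The crude bound 4 is that of the residues in a torus slightly larger than
    the box; it only serves to make the limit superior an infimum of suprema. *)
Lemma box_density_le (R : realType) (E : set (int * int)) (q : nat) :
  box_density R E q <= 4.
Proof.
rewrite /box_density ler_pdivrMr ?ltr0n ?expn_gt0 ?addn1 //.
rewrite -natrM ler_nat -/(size (box_points E q)) -(card_residues E q (2 * q + 2)); last by lia.
apply: leq_trans (max_card _) _; rewrite card_torus; last by lia.
by nia.
Qed.

Lemma upper_density_gt (R : realType) (eps : R) (E : set (int * int)) (n : nat) :
  eps < upper_density R E -> exists2 q, (n <= q)%N & eps < box_density R E q.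
Proof.
move=> lt; apply: contrapT => none.
have small q : (n <= q)%N -> box_density R E q <= eps.
  by move=> nq; rewrite leNgt; apply/negP => gt; apply: none; exists q.
move: lt; rewrite /upper_density.
have bd : bounded_fun (box_density R E).
  exists 4; split => // x x4 q _ /=; rewrite ger0_norm ?divr_ge0 //.
  by apply: le_trans (box_density_le _ _ _) (ltW x4).
rewrite limn_supE // ltNge => /negP; apply.
apply: (@le_trans _ _ (sups (box_density R E) n)).
  apply: ge_inf; last by exists n.
  exact: bounded_fun_has_lbound_sups.
apply: ge_sup.
  by exists (box_density R E n), n => //=.
by move=> _ [q /= nq <-]; apply: small.
Qed.

(** The torus is so large that a congruence between points of the box, up to a
    bounded translation, is an equality. *)
Lemma residue_lift (q W M u v : nat) (x y x' y' : int) :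
  box q (x, y) -> box q (x', y') -> (u <= W)%N -> (v <= W)%N ->
  (2 * q + 2 * W < M)%N -> (1 < M)%N ->
  residue M (x', y') = residue M (x, y) + residue M (from_null_coords (u%:Z, v%:Z)) ->
  x' - x = u%:Z + v%:Z /\ y' - y = v%:Z - u%:Z.
Proof.
move=> [/= hx hy] [/= hx' hy'] uW vW qM M1 e.
have : (x', y') - (x, y) - from_null_coords (u%:Z, v%:Z) = 0.
  apply: (residue_eq0 M) => //; try by rewrite /=; lia.
  apply/eqP; rewrite !raddfB subr_eq0 subr_eq addrC; exact/eqP.
by move=> /(congr1 (fun p => (p.1, p.2))) [] /=; lia.
Qed.

Lemma product_bound (a b c : nat) : (0 < c)%N -> (a * b = c)%N ->
  (a <= c)%N && (b <= c)%N.
Proof. by move=> c0 e; rewrite -e in c0 *; rewrite leq_pmulr ?leq_pmull; nia. Qed.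

Theorem mainTheorem4 (R : realType) (eps : R) (eps_gt0 : 0 < eps) :
  exists d : int, 1 <= d /\
    forall E : set (int * int), eps < upper_density R E ->
      exists x y x' y' : int,
        [/\ E (x, y), E (x', y') & (x - x') ^+ 2 - (y - y') ^+ 2 = d ^+ 2].
Proof.
(* The set in the torus will have density at least eps / 4: the side of the
   torus is less than twice that of the box. *)
have [n n_big] : exists n : nat, 40 < n%:R * (eps / 4) ^+ 2.
  have e2 : 0 < (eps / 4) ^+ 2 by rewrite exprn_gt0 // divr_gt0.
  exists (Num.Def.truncn (40 / (eps / 4) ^+ 2)).+1.
  by rewrite -ltr_pdivrMr //; exact: truncnS_gt.
pose N := (2 * n ^ 2)%N.
pose m := (point_bound N ^ 2).+1.
pose w := (2 ^ N * m`! ^ m)%N.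
have w0 : (0 < w)%N by rewrite muln_gt0 !expn_gt0 fact_gt0.
exists (2 * w)%N%:Z; split; first by lia.
move=> E /(upper_density_gt _ _ _ (2 * w ^ 2)) [q qw dens].
pose M := (2 * q + 1 + 2 * w ^ 2)%N.
have M1 : (2 * q + 1 < M)%N by rewrite /M -[ltnLHS]addn0 ltn_add2l muln_gt0 expn_gt0 w0.
pose A : {pred 'Z_M * 'Z_M} := mem [seq residue M p | p <- box_points E q].
have cardA : #|A| = size (box_points E q) by exact: card_residues.
have cardG : #|{: 'Z_M * 'Z_M}| = (M ^ 2)%N by rewrite card_torus; lia.
have size_gt : eps * ((2 * q + 1) ^ 2)%N%:R < #|A|%:R.
  by rewrite cardA -ltr_pdivlMr // ltr0n expn_gt0 addn1.
have A0 : (0 < #|A|)%N.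
  by rewrite -(ltr0n R); apply: le_lt_trans size_gt; rewrite mulr_ge0 // ltW.
pose pi := [the {additive int * int -> 'Z_M * 'Z_M} of residue M \o from_null_coords].
have form := @averaged_corr_form R ('Z_M * 'Z_M)%type pi A m isT A0.
have delta_ge : eps / 4 <= #|A|%:R / #|{: 'Z_M * 'Z_M}|%:R.
  rewrite cardG ler_pdivlMr ?ltr0n ?expn_gt0; last by apply/orP; left; lia.
  apply: le_trans (ltW size_gt).
  rewrite -mulrA ler_pM2l // mulrC ler_pdivrMr // -natrM ler_nat.
  rewrite (_ : 4 = 2 ^ 2)%N // -expnMn leq_sqr /M.
  by move: qw; move: (w ^ 2)%N => w2; lia.
have e4 : 0 < eps / 4 by rewrite divr_gt0.
have [||||j] := hyperbola_recurrence (n := n) form.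
- exact: lt_le_trans delta_ge.
- apply: lt_le_trans n_big _; apply: ler_wpM2l => //.
  by rewrite ler_pXn2r // nnegrE ltW // (lt_le_trans e4).
- rewrite leqW // -mulnn; apply: leq_trans (leq_pmulr _ _);
  by rewrite /point_bound; lia.
- exact: ltnSn.
move=> /averaged_corr_hit [e [z [/mapP [p Ep ->] /mapP [p' Ep' hit]]]].
pose t := smooth (fun i => e i).
pose s := smooth (fun i => 2 * m - e i)%N.
pose u := (2 ^ j * t)%N; pose v := (2 ^ (2 * N - j) * s)%N.
have uv : (u * v = w ^ 2)%N.
  rewrite /u /v mulnACA smooth_dual -expnD subnKC; last by have := ltn_ord j; lia.
  by rewrite /w expnMn (mulnC 2) expnM.
have /andP[uW vW] : (u <= w ^ 2)%N && (v <= w ^ 2)%N.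
  by apply: product_bound uv; rewrite expn_gt0 w0.
case: p p' hit Ep Ep' => [x y] [x' y'] hit.
rewrite !mem_box_points => /set_mem [Ep box_p] /set_mem [Ep' box_p'].
exists x', y', x, y; split => //.
have [] := residue_lift q (w ^ 2) M u v x y x' y' box_p box_p' uW vW.
- by rewrite /M -addnA ltn_add2l add1n.
- by apply: leq_ltn_trans M1; rewrite addn1.
- by rewrite -hit /u /v !PoszM.
move=> -> ->.
have -> : (u%:Z + v%:Z) ^+ 2 - (v%:Z - u%:Z) ^+ 2 = 4 * (u * v)%N%:Z.
  by rewrite PoszM; ring.
by rewrite uv -mulnn !PoszM; ring.
Qed.
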